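(* Let $X$ be a separable Banach space and let $T$ be a bounded linear operator on $X$. Assume that: (a) $V=\bigcup_{n}\ker(T^n)$ is dense in $X$; (b) there exists a map $S:V\to X$ with $TS=\mathrm{Id}_V$ and $\|Sx\|\leq\|x\|$ for all $x\in V$. Then $\bigcap_{\lambda>1}HC(\lambda T)$ is a dense $G_\delta$ subset of $X$.
   Context: A continuous linear operator $R$ on a topological vector space $X$ is called hypercyclic if there is a vector $x\in X$ whose orbit $\{R^nx:\ n\geq 1\}$ is dense in $X$; such an $x$ is called a hypercyclic vector for $R$, and $HC(R)$ denotes the set of hypercyclic vectors for $R$. Here $\lambda$ ranges over real numbers $>1$. *)

(* Defs.v *)
(* MathComp / MathComp-Analysis *)
From HB Require Import structures.
From mathcomp Require Import all_boot all_order all_algebra.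
From mathcomp Require Import complex.
From mathcomp Require Import all_classical all_reals all_analysis borel_hierarchy.

Set Implicit Arguments.
Unset Strict Implicit.
Unset Printing Implicit Defensive.

Import Order.TTheory GRing.Theory Num.Theory.
Import numFieldNormedType.Exports.

Local Open Scope classical_set_scope.
Local Open Scope ring_scope.

Definition separable_space (X : topologicalType) : Prop :=
  exists2 D : set X, countable D & dense D.

Definition bounded_operator (K : numFieldType) (X : normedModType K)
    (T : {linear X -> X}) : Prop :=
  exists M : K, forall x : X, `|T x| <= M * `|x|.

Definition forward_orbit (X : Type) (R : X -> X) (x : X) : set X :=
  [set iter n R x | n in [set n : nat | (1 <= n)%N]].

(* Linearity and continuity are not part of the definition; R is meant to be
   a continuous linear operator. *)
Definition HC (X : topologicalType) (R : X -> X) : set X :=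
  [set x | dense (forward_orbit R x)].

Definition ker_pow (K : numFieldType) (X : lmodType K) (T : {linear X -> X})
    (n : nat) : set X :=
  [set x | iter n T x = 0].

Definition generalized_kernel (K : numFieldType) (X : lmodType K)
    (T : {linear X -> X}) : set X :=
  \bigcup_n ker_pow T n.

(* In R[i] the relation 1 < l holds exactly when l is real and greater
   than 1; for both choices of scalars these are the real numbers > 1. *)
Definition scalars_gt1 (K : numFieldType) : set K := [set l | 1 < l].
Arguments scalars_gt1 K : clear implicits.

Definition real_or_complex (R : realType) (K : numFieldType) : Prop :=
  K = (R : numFieldType) \/ K = (R[i] : numFieldType).

(* Main.v *)
Require Import Defs.
From HB Require Import structures.
From mathcomp Require Import all_boot all_order all_algebra.
From mathcomp Require Import complex.
From mathcomp Require Import all_classical all_reals all_analysis borel_hierarchy.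
From mathcomp Require Import lra.

Import Order.TTheory GRing.Theory Num.Theory.
Import numFieldNormedType.Exports.

Local Open Scope classical_set_scope.
Local Open Scope ring_scope.

Set Implicit Arguments.
Unset Strict Implicit.
Unset Printing Implicit Defensive.

(* For an open set O and 1 < a <= b, the x such that every l in [a, b] has some
   n >= 1 with l^n T^n x in O form an open set, by compactness of [a, b]. By
   Baire it suffices that this set is dense. Given x0 and y in the generalized
   kernel and u_n = S^n y, take
     x = x0 + sum_(j < q) l_j^(-n_j) u_(n_j),  n_j = (j + 1) N,
   with l_0 = a and l_(j+1) = l_j (1 + 1/((j + 1) m)). For l in [l_j, l_(j+1)],
   T^(n_j) kills x0 and the terms i < j, the term i = j contributes
   (l / l_j)^(n_j) y, which is close to y when N / m is small, and the terms
   i > j are dominated by a geometric series of ratio a^(-N). The l_j are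
   unbounded because the harmonic series diverges, so finitely many of them
   cover [a, b]. *)

(** * Geometric sums and Bernoulli inequalities *)

Lemma sum_geometric_le (R : realFieldType) (t : R) n :
  0 <= t -> 2 * t <= 1 -> \sum_(0 <= k < n) t ^+ k.+1 <= 2 * t.
Proof.
move=> t0 t1; elim: n => [|n IHn]; first by rewrite big_nil mulr_ge0.
rewrite big_nat_recl// expr1 (eq_bigr (fun k => t * t ^+ k.+1)); last first.
  by move=> k _; rewrite exprS.
rewrite -mulr_sumr; have := ler_wpM2l t0 IHn; nra.
Qed.

Lemma bernoulli_le_exprD1 (R : realFieldType) (s : R) k :
  0 <= s -> 1 + k%:R * s <= (1 + s) ^+ k.
Proof.
move=> s0; elim: k => [|k IHk]; first by rewrite mul0r addr0 expr0.
rewrite exprS; apply: le_trans (ler_wpM2l (addr_ge0 ler01 s0) IHk).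
have := mulr_ge0 (ler0n R k) (mulr_ge0 s0 s0); rewrite -natr1; nra.
Qed.

(** The induction rests on [(1 + s)(1 - (k + 1)s) <= 1 - ks]. When [ks <= 1/2] the bound yields
    [(1 + s)^k - 1 <= 2ks], which is how [orbit_approx] uses it. *)
Lemma bernoulli_exprD1_le (R : realFieldType) (s : R) k :
  0 <= s -> s <= 1 -> (1 + s) ^+ k * (1 - k%:R * s) <= 1.
Proof.
move=> s0 s1; elim: k => [|k IHk]; first by rewrite mul0r subr0 expr0 mulr1.
have [ks|ks] := leP 1 (k.+1%:R * s).
  apply: (@le_trans _ _ 0) => //; rewrite mulr_ge0_le0 ?subr_le0//.
  by rewrite exprn_ge0// addr_ge0.
apply: le_trans IHk; rewrite exprSr -mulrA ler_wpM2l//.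
  by rewrite exprn_ge0// addr_ge0.
have := mulr_ge0 (ler0n R k) (mulr_ge0 s0 s0); rewrite -natr1; nra.
Qed.

(** * Scalars with harmonically decreasing relative steps *)

Section Grid.
Context {R : realType} (a : R) (m : nat).
Hypotheses (a0 : 0 < a) (m0 : (0 < m)%N).

Fixpoint grid j : R :=
  if j is i.+1 then grid i * (1 + (i.+1 * m)%:R^-1) else a.

Lemma grid_ge j : a <= grid j.
Proof.
elim: j => //= j IHj; apply: (le_trans IHj).
by rewrite ler_peMr ?lerDl ?invr_ge0// (le_trans (ltW a0)).
Qed.

Lemma grid_gt0 j : 0 < grid j.
Proof. exact: lt_le_trans (grid_ge j). Qed.

Lemma grid_le i j : (i <= j)%N -> grid i <= grid j.
Proof.
move=> /subnK <-; elim: (j - i)%N => [//|k IHk] /=.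
apply: (le_trans IHk).
by rewrite ler_peMr ?lerDl ?invr_ge0// ltW ?grid_gt0.
Qed.

(* (1 + 1/(jm))^m >= 1 + 1/j, and the right-hand sides telescope *)
Lemma grid_expr_ge j : a ^+ m * j.+1%:R <= grid j ^+ m.
Proof.
elim: j => [|j IHj] /=; first by rewrite mulr1.
rewrite exprMn; apply: (@le_trans _ _ (a ^+ m * j.+1%:R * (1 + j.+1%:R^-1))).
  rewrite -!mulrA ler_wpM2l ?exprn_ge0 ?(ltW a0)//.
  by rewrite mulrDr mulr1 divff ?natr1 ?pnatr_eq0.
apply: ler_pM => //.
- by rewrite mulr_ge0// exprn_ge0// (ltW a0).
- apply: le_trans (@bernoulli_le_exprD1 _ _ m _); last by rewrite invr_ge0.
  by rewrite lerD2l natrM invfM mulrCA divff ?mulr1// pnatr_eq0 -lt0n.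
Qed.

Lemma grid_unbounded (b : R) : exists q, b < grid q.
Proof.
have am : 0 < a ^+ m by rewrite exprn_gt0.
(* By [grid_expr_ge] it suffices that [q + 1 > |b|^m / a^m]; the absolute value makes the comparison
   of [m]-th powers legitimate for negative [b]. *)
exists (Num.truncn (`|b| ^+ m / a ^+ m)); set q := Num.truncn _.
have := truncnS_gt (`|b| ^+ m / a ^+ m); rewrite -/q ltr_pdivrMr// mulrC => bq.
have := lt_le_trans bq (grid_expr_ge q).
rewrite ltr_pXn2r// ?nnegrE ?(ltW (grid_gt0 q))//.
by apply: le_lt_trans; exact: ler_norm.
Qed.

Lemma grid_bracket l q : a <= l -> l < grid q ->
  exists2 j, (j < q)%N & grid j <= l < grid j.+1.
Proof.
move=> al; elim: q => [|q IHq] lq; first by move: lq; rewrite /= ltNge al.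
have [ql|/IHq[j jq jl]] := leP (grid q) l; first by exists q; rewrite ?ql.
by exists j => //; rewrite ltnS ltnW.
Qed.

End Grid.

(** * One vector serving a whole segment of scalars *)

Lemma iter_linear (K : numFieldType) (X : lmodType K) (T : {linear X -> X}) n :
  exists L : {linear X -> X}, forall x, iter n T x = L x.
Proof.
have linT : linear (iter n T).
  by move=> c x y; elim: n => [//|n /= ->]; rewrite linearP.
pose L : {linear X -> X} :=
  HB.pack (iter n T) (GRing.isLinear.Build _ _ _ _ _ linT).
by exists L.
Qed.

(* Both K = R and K = R[i] are handled through an order embedding f of R onto
   the real elements of K; the norms of X, valued in K, are read in R via g. *)
Section RealNorm.
Context {R : realType} {K : numFieldType} (f : {rmorphism R -> K}) (g : K -> R).
Hypotheses (f_le : {mono f : x y / x <= y})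
  (fgK : forall x, 0 <= x -> f (g x) = x).
Context {X : normedModType K}.

Definition rnorm (x : X) : R := g `|x|.

Lemma rnormE x : f (rnorm x) = `|x|.
Proof. by rewrite fgK. Qed.

Lemma rnorm_ge0 x : 0 <= rnorm x.
Proof. by rewrite -f_le rmorph0 rnormE. Qed.

Lemma rnorm0 : rnorm 0 = 0.
Proof. by apply: (fmorph_inj f); rewrite rmorph0 rnormE normr0. Qed.

Lemma rnormD x y : rnorm (x + y) <= rnorm x + rnorm y.
Proof. by rewrite -f_le rmorphD /= !rnormE ler_normD. Qed.

Lemma rnormB x y : rnorm (x - y) = rnorm (y - x).
Proof. by rewrite /rnorm distrC. Qed.

Lemma rnormZ c x : 0 <= c -> rnorm (f c *: x) = c * rnorm x.
Proof.
move=> c0; apply: (fmorph_inj f).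
by rewrite rmorphM /= !rnormE normrZ ger0_norm// -(rmorph0 f) f_le.
Qed.

Lemma rnorm_sum (I : Type) (r : seq I) (P : pred I) (F : I -> X) :
  rnorm (\sum_(i <- r | P i) F i) <= \sum_(i <- r | P i) rnorm (F i).
Proof.
elim/big_ind2 : _ => [|x1 y1 x2 y2 h1 h2|//]; first by rewrite rnorm0.
by rewrite (le_trans (rnormD _ _)) ?lerD.
Qed.

(** Exponents start at 1, so the whole sum is small with [t]. This bounds both the distance from
    [x0] ([i = 0]) and the terms beyond the active index. *)
Lemma sum_scale_le (u : nat -> X) (k : nat -> nat) (c : nat -> R) (t : R) i j :
  (forall n, rnorm (u n) <= rnorm (u 0%N)) -> 0 <= t -> 2 * t <= 1 ->
  (forall n, (i <= n < j)%N -> 0 <= c n <= t ^+ (n - i).+1) ->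
  rnorm (\sum_(i <= n < j) f (c n) *: u (k n)) <= 2 * t * rnorm (u 0%N).
Proof.
move=> ub t0 t1 hc; apply: (le_trans (rnorm_sum _ _ _)).
apply: (@le_trans _ _ (\sum_(i <= n < j) t ^+ (n - i).+1 * rnorm (u 0%N))).
  rewrite big_nat_cond [leRHS]big_nat_cond.
  apply: ler_sum => n /andP[/hc/andP[c0 ct] _].
  by rewrite rnormZ// ler_pM// rnorm_ge0.
rewrite -mulr_suml ler_wpM2r ?rnorm_ge0//.
rewrite -[X in index_iota X _]add0n big_addn (eq_bigr (fun k => t ^+ k.+1)).
  exact: sum_geometric_le.
by move=> n _; rewrite addnK.
Qed.

Lemma orbit_approx (T : {linear X -> X}) (u : nat -> X) (x0 : X) p a b d :
    (forall n, T (u n.+1) = u n) -> (forall n, rnorm (u n) <= rnorm (u 0%N)) ->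
    iter p T (u 0%N) = 0 -> iter p T x0 = 0 -> 1 < a -> 0 < d ->
  exists2 x, rnorm (x0 - x) < d &
    forall l, a <= l <= b -> exists2 n, (1 <= n)%N &
      rnorm (f l ^+ n *: iter n T x - u 0%N) < d.
Proof.
move=> Tu ub Tu0 Tx0 a1 d0.
have a0 : 0 < a by exact: lt_trans a1.
set B := rnorm (u 0%N); have B0 : 0 <= B := rnorm_ge0 _.
have iter0 n : iter n T 0 = 0 by elim: n => //= n ->; rewrite linear0.
have Tx0_ge n : (p <= n)%N -> iter n T x0 = 0.
  by move=> pn; rewrite -(subnK pn) iterD Tx0 iter0.
have Tui n k : iter n T (u (n + k)%N) = u k.
  by elim: n => // n IHn; rewrite iterSr addSn Tu.
have Tu_gt n k : (k + p <= n)%N -> iter n T (u k) = 0.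
  move=> /subnK <-; rewrite (addnC k) !iterD.
  by have := Tui k 0; rewrite addn0 => ->; rewrite Tu0 iter0.
have M0 : 0 <= 2 + 4 * B / d by rewrite addr_ge0// divr_ge0 ?mulr_ge0// ltW.
(* The final error is at most [2cB + 2tB] with [t = a^-N] and [c = N/m], so each of [4tB] and [4cB]
   is made smaller than [d]. Bernoulli gives [a^N > 2 + 4B/d]; then [m > N(2 + 4B/d)] is chosen
   after [N]. *)
have [N [N0 pN tB t1]] : exists N, [/\ (0 < N)%N, (p <= N)%N,
    4 * a ^- N * B < d & 2 * a ^- N <= 1].
  pose k := Num.truncn ((2 + 4 * B / d) / (a - 1)).
  exists (p + k).+1.
  have aN : 2 + 4 * B / d < a ^+ (p + k).+1.
    have := @bernoulli_le_exprD1 _ (a - 1) (p + k).+1.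
    rewrite subrKC subr_ge0 (ltW a1) => /(_ isT); apply: lt_le_trans.
    have := truncnS_gt ((2 + 4 * B / d) / (a - 1)).
    rewrite -/k ltr_pdivrMr ?subr_gt0// => kM.
    have := mulr_ge0 (ler0n R p) (ltW (etrans (subr_gt0 _ _) a1)).
    by rewrite -addnS natrD; nra.
  have aN0 : 0 < a ^+ (p + k).+1 by rewrite exprn_gt0.
  have Bd : 0 <= 4 * B / d by rewrite divr_ge0 ?mulr_ge0// ltW.
  split; rewrite ?ltnS ?leqW ?leq_addr//; last first.
    by rewrite ler_pdivrMr// mul1r; lra.
  rewrite mulrAC ltr_pdivrMr// [d * _]mulrC -ltr_pdivrMr//; lra.
have [m [m0 mB c1]] : exists m, [/\ (0 < m)%N,
    4 * (N%:R / m%:R) * B < d & 2 * (N%:R / m%:R) <= 1 :> R].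
  pose k := Num.truncn (N%:R * (2 + 4 * B / d)).
  exists k.+1; have := truncnS_gt (N%:R * (2 + 4 * B / d)); rewrite -/k => kM.
  have NB : 0 <= N%:R * (4 * B / d).
    by rewrite mulr_ge0// divr_ge0 ?mulr_ge0// ltW.
  have N0' := ler0n R N.
  split => //; last by rewrite mulrA ler_pdivrMr// mul1r; lra.
  rewrite mulrA mulrAC ltr_pdivrMr// [d * _]mulrC -ltr_pdivrMr//.
  by rewrite mulrAC [4 * _]mulrC -!mulrA; lra.
set t := a ^- N in tB t1; set c := N%:R / m%:R in mB c1.
have t0 : 0 < t by rewrite invr_gt0 exprn_gt0.
have [q bq] := grid_unbounded a0 m0 b.
pose l_ := grid a m; pose n_ j := (j.+1 * N)%N.
have l0 j : 0 < l_ j := grid_gt0 m a0 j.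
have l_t j k : l_ j ^- (k * N) <= t ^+ k.
  rewrite /t exprVn -exprM mulnC lef_pV2 ?posrE ?exprn_gt0//.
  by rewrite lerXn2r ?nnegrE ?(ltW a0) ?(ltW (l0 _))//; exact: grid_ge.
exists (x0 + \sum_(0 <= j < q) f (l_ j ^- n_ j) *: u (n_ j)).
  rewrite rnormB addrC addKr.
  apply: (@le_lt_trans _ _ (2 * t * B)).
    apply: sum_scale_le => // [|j _]; first exact: ltW.
    by rewrite subn0 l_t invr_ge0 exprn_ge0// ltW.
  have := mulr_ge0 (ltW t0) B0; lra.
move=> l /andP[al lb].
have l_gt0 : 0 < l by exact: lt_le_trans al.
have [j jq /andP[jl lj]] := grid_bracket al (le_lt_trans lb bq).
exists (n_ j); first by rewrite muln_gt0.
have [L LE] := iter_linear T (n_ j).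
rewrite !LE linearD -LE Tx0_ge ?add0r; last first.
  by rewrite (leq_trans pN)// leq_pmull.
rewrite linear_sum (@big_cat_nat _ _ _ j)//= ?(ltnW jq)//.
(* For [i < j], [n_j >= n_i + N >= n_i + p], so [T^(n_j)] kills [u_(n_i)]. *)
rewrite big1_seq ?add0r; last first.
  move=> i /andP[_]; rewrite mem_index_iota => /andP[_ ij].
  rewrite linearZ /= -LE Tu_gt ?scaler0//.
  rewrite /n_ (leq_trans (leq_add (leqnn _) pN))//.
  by rewrite addnC -mulSn leq_mul2r ltnS ij orbT.
rewrite big_ltn// linearZ /= -LE -[X in u X]addn0 Tui scalerDr scalerA.
rewrite -rmorphXn -rmorphM.
rewrite addrAC -[X in _ - X]scale1r -(rmorph1 f) -scalerBl -rmorphB /=.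
(* The relative error [(l / l_j)^(n_j) - 1] of the active term, nonnegative since [l >= l_j]. *)
set e := _ - 1.
have e0 : 0 <= e.
  rewrite subr_ge0 -exprVn -exprMn exprn_ege1// ler_pdivlMr ?mul1r//.
(* Here [l / l_j <= 1 + s] with [s = 1/((j + 1)m)], and [n_j s = N/m] does not depend on [j]: the
   shrinking steps compensate the growing exponents. Then [(e + 1)(1 - c) <= 1] and [2c <= 1] give
   the bound. *)
have ec : e <= 2 * c.
  pose s : R := (j.+1 * m)%:R^-1.
  have s0 : 0 <= s by rewrite invr_ge0.
  have s1 : s <= 1 by rewrite invf_le1 ?ler1n ?ltr0n ?muln_gt0.
  have sc : (n_ j)%:R * s = c.
    by rewrite /s /c /n_ !natrM invfM mulrACA divff ?mul1r// pnatr_eq0.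
  have := bernoulli_exprD1_le (n_ j) s0 s1; rewrite sc => es.
  have : e + 1 <= (1 + s) ^+ n_ j.
    rewrite subrK -exprVn -exprMn lerXn2r ?nnegrE ?divr_ge0 ?addr_ge0//
      ?(ltW l_gt0) ?(ltW (l0 _))//.
    by rewrite ler_pdivrMr// mulrC ltW.
  have c0 : 0 <= c by rewrite divr_ge0.
  nra.
apply: (@le_lt_trans _ _ (e * B + 2 * t * B)); last first.
  have := ler_wpM2r B0 ec; have := mulr_ge0 (ltW t0) B0; lra.
apply: (le_trans (rnormD _ _)); rewrite (rnormZ _ e0) lerD2l.
(* For [i > j], [l <= l_(j+1) <= l_i], so the coefficient [l^(n_j) l_i^(-n_i)] is at most
   [l_i^(-(i - j)N) <= t^(i - j)]. *)
rewrite scaler_sumr big_seq_cond.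
rewrite (eq_bigr (fun i => f (l ^+ n_ j * l_ i ^- n_ i) *: u (n_ i - n_ j)%N)).
  rewrite -big_seq_cond; apply: sum_scale_le => // [|i /andP[ji iq]].
    exact: ltW.
  rewrite mulr_ge0 ?invr_ge0 ?exprn_ge0 ?(ltW l_gt0) ?(ltW (l0 _))//=.
  have nij : n_ i = ((i - j.+1).+1 * N + n_ j)%N.
    by rewrite /n_ -mulnDl addSn subnK.
  apply: le_trans (l_t i _).
  rewrite ler_pdivrMr ?exprn_gt0// nij exprD mulKf ?expf_neq0 ?gt_eqF//.
  rewrite lerXn2r ?nnegrE ?(ltW l_gt0) ?(ltW (l0 _))//.
  by rewrite (le_trans (ltW lj))//; apply: grid_le.
move=> i /andP[]; rewrite mem_index_iota => /andP[ji _] _.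
rewrite linearZ /= -LE scalerA rmorphM; congr (_ *: _).
have nij : (n_ j <= n_ i)%N by rewrite leq_mul2r ltnS (ltnW ji) orbT.
by rewrite -{1}(subnKC nij) Tui.
Qed.
End RealNorm.

(** * Baire category and the common hypercyclic vectors *)

Section RealScalars.
Context {R : realType} {K : numFieldType} (f : {rmorphism R -> K}) (g : K -> R).
Hypotheses (f_le : {mono f : x y / x <= y})
  (fgK : forall x, 0 <= x -> f (g x) = x).

Lemma real_emb_lt : {mono f : x y / x < y}.
Proof. exact: leW_mono. Qed.

Lemma real_emb_gt0 x : (0 < f x) = (0 < x).
Proof. by rewrite -real_emb_lt rmorph0. Qed.

Lemma real_emb_norm x : `|f x| = f `|x|.
Proof.
have [x0|x0] := leP 0 x; first by rewrite !ger0_norm// -(rmorph0 f) f_le.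
by rewrite !ltr0_norm ?rmorphN// -(rmorph0 f) real_emb_lt.
Qed.

Lemma real_emb_continuous : continuous (f : R -> K).
Proof.
move=> x; apply/cvgrPdist_lt => e e0.
have ge0 : 0 < g e by rewrite -real_emb_gt0 fgK// ltW.
near=> y; rewrite -rmorphB real_emb_norm -(fgK (ltW e0)) real_emb_lt.
by near: y; apply: cvgr_dist_lt.
Unshelve. all: by end_near. Qed.

Lemma nbhs_rnormP (X : normedModType K) (x : X) (A : set X) :
  nbhs x A <-> exists2 e, 0 < e & forall y, rnorm g (x - y) < e -> A y.
Proof.
split=> [/nbhs_ballP[e /= e0 eA]|[e e0 eA]].
  exists (g e); first by rewrite -real_emb_gt0 fgK// ltW.
  move=> y xy; apply: eA; rewrite -ball_normE /=.
  by rewrite -(rnormE fgK) -(fgK (ltW e0)) real_emb_lt.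
apply/nbhs_ballP; exists (f e); first by rewrite /= real_emb_gt0.
move=> y; rewrite -ball_normE /= -(rnormE fgK) real_emb_lt; exact: eA.
Qed.

(* Baire in the library is restricted to realType scalars, hence not applicable
   when K = R[i]. *)
Lemma dense_bigcap (X : completeNormedModType K) (F : nat -> set X) :
  (forall n, open (F n) /\ dense (F n)) -> dense (\bigcap_n F n).
Proof.
move=> oF O O0 oO.
pose N (x : X) : R := rnorm g x.
have ND x y z : N (x - z) <= N (x - y) + N (y - z).
  by rewrite -[x in N (x - z)](subrK y) -addrA; apply: rnormD.
(* Halving the radius puts a closed ball inside [B]; closed balls will retain the limit of the
   centers. *)
have shrink (B : set X) x n : open B -> B x -> exists2 e, 0 < e <= n.+1%:R^-1 &
    forall y, N (x - y) <= e -> B y.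
  move=> oB Bx; have /nbhs_rnormP[e e0 eB] : nbhs x B by apply: open_nbhs_nbhs.
  exists (Num.min (e / 2) n.+1%:R^-1).
    by rewrite lt_min divr_gt0//= invr_gt0 ltr0n ge_min lexx orbT.
  move=> y xy; apply: eB; apply: (le_lt_trans xy).
  by rewrite gt_min ltr_pdivrMr// ltr_pMr// ltr1n.
(* One stage of the nested balls: from center and radius at stage [n], a smaller closed ball inside
   the open ball and [F n]. Positivity of the radius is a premise under the existential so that
   [choice] applies to all triples; otherwise the old pair is a dummy value. *)
have step (s : nat * (X * R)) : exists s' : X * R, 0 < s.2.2 ->
    0 < s'.2 <= s.1.+1%:R^-1 /\ forall y, N (s'.1 - y) <= s'.2 ->
      N (s.2.1 - y) < s.2.2 /\ F s.1 y.
  case: s => n [x r] /=; have [r0|] := boolP (0 < r); last by exists (x, r).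
  have oB : open (ball x (f r)) by apply: ball_open; rewrite real_emb_gt0.
  have [oFn dFn] := oF n.
  have [|y [xy Fy]] := dFn _ _ oB.
    by exists x; apply: ballxx; rewrite real_emb_gt0.
  have [//|e e0 eB] := shrink (ball x (f r) `&` F n) y n (openI oB oFn).
  exists (y, e) => _; split => // z /eB[xz Fz]; split => //.
  by move: xz; rewrite -ball_normE /= -(rnormE fgK) real_emb_lt.
have {step}[next nextP] := choice step.
have [x0 Ox0] := O0; have [//|r0 /andP[r0_gt0 _] r0O] := shrink O x0 0%N oO.
pose s := fix s n := if n is m.+1 then next (m, s m) else (x0, r0).
have s_gt0 n : 0 < (s n).2.
  by elim: n => //= n IHn; have [/andP[]] := nextP (n, s n) IHn.
have s_le n : (s n.+1).2 <= n.+1%:R^-1.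
  by have [/andP[]] := nextP (n, s n) (s_gt0 n).
have s_sub n y : N ((s n.+1).1 - y) <= (s n.+1).2 ->
    N ((s n).1 - y) < (s n).2 /\ F n y.
  by have [_] := nextP (n, s n) (s_gt0 n); apply.
have s_subn n k y : N ((s (k + n)%N).1 - y) <= (s (k + n)%N).2 ->
    N ((s n).1 - y) <= (s n).2.
  by elim: k => [|k IHk] h; [exact: h|apply: IHk; have [/ltW] := s_sub _ _ h].
have s_ball n k : N ((s n).1 - (s (k + n)%N).1) <= (s n).2.
  by apply: (s_subn n k); rewrite subrr /N (rnorm0 fgK) ltW.
have cvg_s : cvg ((fun n => (s n).1) @ \oo).
  apply/cauchy_cvgP/cauchy_exP => e e0.
  have ge0 : 0 < g e by rewrite -real_emb_gt0 fgK// ltW.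
  pose k := Num.truncn (g e)^-1.
  exists (s k.+1).1; exists k.+1 => // n /= /subnK <-.
  rewrite -ball_normE /= -(rnormE fgK) -(fgK (ltW e0)) real_emb_lt.
  apply: (le_lt_trans (s_ball k.+1 _)); apply: (le_lt_trans (s_le k)).
  by rewrite invf_plt ?posrE// truncnS_gt.
have [l sl] : exists l : X, (fun n => (s n).1) @ \oo --> l.
  by exists (lim ((fun n => (s n).1) @ \oo)).
(* All later centers lie in the closed ball of stage [n], hence so does their limit. *)
have Nl n : N ((s n).1 - l) <= (s n).2.
  apply/ler_addgt0Pr => e e0.
  have /sl[m _ ml] : nbhs l [set y | N (l - y) < e].
    by apply/nbhs_rnormP; exists e.
  have := ml (m + n)%N (leq_addr _ _); rewrite /= /N rnormB -/(N _) => le.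
  apply: le_trans (ND _ (s (m + n)%N).1 _) _.
  by rewrite lerD// ltW.
by exists l; split => [|n _]; [exact/r0O/(Nl 0%N) | case: (s_sub n l)].
Qed.

(** A tube argument: by joint continuity, an [n] that works for [(l, x)] works for all nearby pairs,
    and compactness of the segment gives one neighborhood of [x] for all [l]. *)
Lemma open_forall_segment (X : normedModType K) (T : X -> X) (a b : R)
    (O : set X) : continuous T -> open O ->
  open [set x | forall l, a <= l <= b ->
    exists2 n, (1 <= n)%N & O (f l ^+ n *: iter n T x)].
Proof.
move=> cT oO; rewrite openE => x hx.
have cTn n : continuous (iter n T).
  elim: n => [|n IHn] y /=; first exact: cvg_id.
  by apply: continuous_comp; [exact: IHn | exact: cT].
pose P y l := exists2 n, (1 <= n)%N & O (f l ^+ n *: iter n T y).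
have seg : \forall y \near x, `[a, b] `<=` P y.
  apply: (proj1 (compact_near_coveringP _) (@segment_compact R a b)) => l /=.
  rewrite in_itv /= => /hx[n n1 On].
  have cvg_lx : (fun z : R * X => f (z.1 ^+ n) *: iter n T z.2) @
      filter_prod (nbhs l) (nbhs x) --> f (l ^+ n) *: iter n T x.
    apply: cvgZ.
      apply: (@cvg_comp _ _ _ fst (fun r : R => f (r ^+ n)) _ (nbhs l)).
        exact: cvg_fst.
      exact: (continuous_comp (@exprn_continuous R n l)
        (@real_emb_continuous _)).
    apply: (@cvg_comp _ _ _ snd (iter n T) _ (nbhs x)); first exact: cvg_snd.
    exact: cTn.
  have : nbhs (f (l ^+ n) *: iter n T x) O.
    by rewrite rmorphXn; apply: open_nbhs_nbhs.
  move=> /cvg_lx near_lx.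
  have : filter_prod (nbhs l) (nbhs x) [set z | P z.2 z.1].
    apply: (@filterS _ (filter_prod (nbhs l) (nbhs x)) _ _ _ _ near_lx).
    by move=> -[l' y] /= Oy; exists n; rewrite // -rmorphXn.
  exact.
by apply: filterS seg => y yP l lab; apply: yP; rewrite /= in_itv.
Qed.

(** [F] is a total extension of the right inverse that preserves the generalized kernel, so it can
    be iterated there. *)
Lemma common_hypercyclic_dense_Gdelta (X : completeNormedModType K)
    (T : {linear X -> X}) (F : X -> X) :
  separable_space X -> continuous T -> dense (generalized_kernel T) ->
  (forall x, generalized_kernel T x ->
     [/\ generalized_kernel T (F x), T (F x) = x & `|F x| <= `|x|]) ->
  let common := \bigcap_(lambda in scalars_gt1 K) HC (lambda \*: T) in
  dense common /\ Gdelta common.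
Proof.
move=> [D cD dD] cT dV FP common.
have HCE (l : K) x n : iter n (l \*: T) x = l ^+ n *: iter n T x.
  elim: n => [|n IHn]; first by rewrite expr0 scale1r.
  by rewrite !iterS IHn /= linearZ scalerA -exprS.
have [d Dd] : exists d : nat -> X, forall x, D x -> exists i, d i = x.
  have /pfcard_geP[D0|[d]] := cD; first by exists (fun=> 0) => x; rewrite D0.
  by exists d => x /(@surj _ _ _ _ d)[i _ di]; exists i.
pose O_ i k : set X := ball (d i) (f k.+1%:R^-1).
have oO i k : open (O_ i k) by apply: ball_open; rewrite real_emb_gt0 invr_gt0.
(* The segments [[1 + 1/(m + 1), m + 1]] exhaust the reals above 1 (the one for [m = 0] is empty),
   which replaces the uncountable intersection by a countable one over center, radius and
   segment. *)
pose A i k m := [set x | forall l, 1 + m.+1%:R^-1 <= l <= m.+1%:R ->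
    exists2 n, (1 <= n)%N & O_ i k (f l ^+ n *: iter n T x)].
pose A_ j := if unpickle j is Some (i, k, m) then A i k m else setT.
have oA i k m : open (A i k m) by apply: open_forall_segment.
have dA i k m : dense (A i k m).
  move=> W W0 oW.
  have [x0 [Wx0 [p1 _ Tx0]]] := dV _ W0 oW.
  have [|y [Oy [p2 _ Ty]]] := dV _ _ (oO i k).
    by exists (d i); apply: ballxx; rewrite real_emb_gt0 invr_gt0.
  have /nbhs_rnormP[e1 e10 e1W] : nbhs x0 W by apply: open_nbhs_nbhs.
  have /nbhs_rnormP[e2 e20 e2O] : nbhs y (O_ i k) by apply: open_nbhs_nbhs.
  pose u n := iter n F y.
  have Vu n : generalized_kernel T (u n).
    by elim: n => [|n /FP[]//]; exists p2.
  have Tu n : T (u n.+1) = u n by have [] := FP _ (Vu n).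
  have ub n : rnorm g (u n) <= rnorm g (u 0%N).
    elim: n => // n; apply: le_trans.
    by rewrite -f_le !(rnormE fgK); have [] := FP _ (Vu n).
  have iter0 n : iter n T 0 = 0 by elim: n => //= n ->; rewrite linear0.
  (* A common exponent killing both [x0] and [y]. *)
  have Tu0 : iter (p1 + p2) T (u 0%N) = 0 by rewrite iterD Ty iter0.
  have Tx00 : iter (p1 + p2) T x0 = 0 by rewrite addnC iterD Tx0 iter0.
  have a1 : 1 < 1 + m.+1%:R^-1 :> R by rewrite ltrDl invr_gt0.
  have e0 : 0 < Num.min e1 e2 by rewrite lt_min e10.
  have [x x0x xO] := orbit_approx f_le fgK m.+1%:R Tu ub Tu0 Tx00 a1 e0.
  exists x; split; first by apply: e1W; rewrite (lt_le_trans x0x)// ge_min lexx.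
  move=> l /xO[n n1 lO]; exists n => //; apply: e2O.
  by rewrite rnormB (lt_le_trans lO)// ge_min lexx orbT.
have oA_ j : open (A_ j) /\ dense (A_ j).
  rewrite /A_; case: (unpickle j) => [[[i k] m]|]; first by split.
  by split; [exact: openT | move=> W W0 _; rewrite setIT].
have commonE : common = \bigcap_j A_ j.
  apply/seteqP; split=> x.
    move=> hx j _; rewrite /A_.
    case: (unpickle j) => [[[i k] m]|//] l /andP[l1 _].
    have fl1 : scalars_gt1 K (f l).
      rewrite /scalars_gt1 /= -(rmorph1 f) real_emb_lt (lt_le_trans _ l1)//.
      by rewrite ltrDl invr_gt0.
    have [|y [Oy [n n1 yE]]] := hx _ fl1 (O_ i k) _ (oO i k).
      by exists (d i); apply: ballxx; rewrite real_emb_gt0 invr_gt0.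
    by exists n; rewrite // -HCE yE.
  move=> hx lambda lambda1 O [z Oz] oO'.
  (* Being nonnegative, [lambda] equals [f l] for the real [l = g lambda]. *)
  have l0 : 0 <= lambda by rewrite (le_trans ler01)// ltW.
  move: lambda1; rewrite /scalars_gt1 /= -(fgK l0) -(rmorph1 f) real_emb_lt.
  (* The radius [1/(k + 1)] is below [e / 2]: it is spent once from [z] to [d i] and once from [d i]
     to the orbit. *)
  set l := g lambda => l1.
  have /nbhs_rnormP[e e0 eO] : nbhs z O by apply: open_nbhs_nbhs.
  pose k := Num.truncn (2 / e).
  have k2 : k.+1%:R^-1 < e / 2.
    by rewrite invf_plt ?posrE ?divr_gt0// invf_div truncnS_gt.
  have k0 : 0 < f k.+1%:R^-1 by rewrite real_emb_gt0 invr_gt0.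
  have oz : open (ball z (f k.+1%:R^-1)) by exact: ball_open.
  have [|y [zy /Dd[i iy]]] := dD _ _ oz.
    by exists z; apply: ballxx.
  move: zy; rewrite -iy -ball_normE /= -(rnormE fgK) real_emb_lt => zd.
  pose m := maxn (Num.truncn (l - 1)^-1) (Num.truncn l).
  have lm : 1 + m.+1%:R^-1 <= l <= m.+1%:R.
    apply/andP; split.
      rewrite addrC -lerBrDr invf_ple ?posrE ?subr_gt0//.
      by rewrite (le_trans (ltW (truncnS_gt _)))// ler_nat ltnS leq_maxl.
    by rewrite (le_trans (ltW (truncnS_gt _)))// ler_nat ltnS leq_maxr.
  have := hx (pickle (i, k, m)) I; rewrite /A_ pickleK => /(_ l lm)[n n1 On].
  exists (f l ^+ n *: iter n T x); split; last by exists n; rewrite ?HCE.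
  apply: eO; rewrite -[z](subrK (d i)) -addrA.
  rewrite (le_lt_trans (rnormD f_le fgK _ _))//.
  move: On; rewrite /O_ -ball_normE /= -(rnormE fgK) real_emb_lt => On.
  by rewrite [e]splitr ltrD// (lt_trans _ k2).
split; last by exists A_ => // j; have [] := oA_ j.
by rewrite commonE; apply: dense_bigcap.
Qed.
End RealScalars.

(** * Reduction of the theorem's hypotheses *)

Lemma bounded_operator_continuous (K : numFieldType) (X : normedModType K)
    (T : {linear X -> X}) : bounded_operator T -> continuous T.
Proof.
move=> [M TM]; apply/linear_bounded_continuous/linear_boundedP.
(* [M] need not be real, hence its norm; [M * |x|] is nonnegative because it dominates [|T x|]. *)
exists `|M|; split => [|r Mr x]; first exact: normr_real.
apply: (le_trans (TM x)); rewrite -[M * _]ger0_norm ?(le_trans _ (TM x))//.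
by rewrite normrM normr_id ler_wpM2r// ltW.
Qed.

(** [S] maps the generalized kernel into itself, since [T^(p+1) (S x) = T^p x]. Outside it the
    extension takes the arbitrary value 0. *)
Lemma ker_right_inverse (K : numFieldType) (X : normedModType K)
    (T : {linear X -> X}) :
  (exists S : generalized_kernel T -> X,
    (forall x, T (S x) = set_val x) /\ (forall x, `|S x| <= `|set_val x|)) ->
  exists F : X -> X, forall x, generalized_kernel T x ->
    [/\ generalized_kernel T (F x), T (F x) = x & `|F x| <= `|x|].
Proof.
move=> [S [TS NS]].
suff /choice[F FP] : forall x, exists y, generalized_kernel T x ->
  [/\ generalized_kernel T y, T y = x & `|y| <= `|x|] by exists F.
move=> x; have [Vx|] := pselect (generalized_kernel T x); last by exists 0.
pose v : generalized_kernel T := SigSub (mem_set Vx).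
have vx : set_val v = x by [].
exists (S v) => _; split; rewrite -?[x in RHS]vx -?[x in leRHS]vx//.
have [p _ Tx] := Vx; exists p.+1 => //.
by rewrite /ker_pow /= -iterS iterSr TS.
Qed.

Theorem theorem5 (R : realType) (K : numFieldType)
    (K_scalars : real_or_complex R K)
    (X : completeNormedModType K) (X_separable : separable_space X)
    (T : {linear X -> X}) (T_bounded : bounded_operator T)
    (ker_dense : dense (generalized_kernel T))
    (right_inverse : exists S : generalized_kernel T -> X,
        (forall x : generalized_kernel T, T (S x) = set_val x) /\
        (forall x : generalized_kernel T, `|S x| <= `|set_val x|)) :
  let common := \bigcap_(lambda in scalars_gt1 K) HC (lambda \*: T) in
  dense common /\ Gdelta common.
Proof.
have cT := bounded_operator_continuous T_bounded.
have [F FP] := ker_right_inverse right_inverse.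
(* Identities for [K = R]; for [R[i]], the inclusion of the reals and the real part, a nonnegative
   complex number having zero imaginary part. *)
have [f [g [f_le fgK]]] : exists (f : {rmorphism R -> K}) (g : K -> R),
    {mono f : x y / x <= y} /\ forall x, 0 <= x -> f (g x) = x.
  clear -K_scalars; case: K_scalars => KE; subst K.
    by exists idfun, id.
  exists (real_complex R), (@complex.Re R); split => [x y|[x y]].
    exact: lecR.
  by rewrite lecE /= => /andP[/eqP -> _].
exact: (common_hypercyclic_dense_Gdelta f_le fgK X_separable cT ker_dense FP).
Qed.
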